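(* Let $\mathcal A$ be a unital Banach algebra such that $\mathrm{Asy}(\mathcal A)$ has stable rank one. Then $\mathcal A$ also has stable rank one.
   Context: Banach algebras are complex and have a contractive product $\|ab\|\le\|a\|\|b\|$; a unital Banach algebra has unit $1$ with $\|1\|=1$. For a Banach algebra $\mathcal A$, $\ell^\infty(\mathcal A)$ is the Banach algebra of all bounded sequences in $\mathcal A$ indexed by $\mathbb N$, with pointwise operations and the supremum norm; $c_0(\mathcal A)$ is the closed two-sided ideal of sequences converging to $0$ in norm; and $\mathrm{Asy}(\mathcal A)=\ell^\infty(\mathcal A)/c_0(\mathcal A)$ with the quotient norm. A unital Banach algebra $\mathcal A$ has stable rank one if its group of invertible elements $\mathrm{inv}(\mathcal A)$ is norm dense in $\mathcal A$. *)

(* Defs.v *)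
From HB Require Import structures.
From mathcomp Require Import all_boot all_order all_algebra.
From mathcomp Require Import generic_quotient ring_quotient.
From mathcomp Require Import all_classical all_reals all_analysis.
From mathcomp Require Import complex ring.

Set Implicit Arguments.
Unset Strict Implicit.
Unset Printing Implicit Defensive.

Import Order.TTheory GRing.Theory Num.Theory.
Import numFieldNormedType.Exports.

Local Open Scope classical_set_scope.
Local Open Scope ring_scope.
Local Open Scope quotient_scope.
Local Open Scope complex_scope.

(* A numDomainType is both a ring and a normed module over itself, so no HB
   structure can join GRing.NzRing with Num.NormedZmodule over another scalar
   field.  The norm of an algebra is therefore a field of its own, [alg_norm],
   from which the library norm [`|_|], the topology and the uniformity of every
   unitalNormedAlgType are derived by [Lmodule_isNormed]. *)
HB.mixin Record UnitAlgebra_isUnitalNormed (K : numFieldType) A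
    & GRing.UnitAlgebra K A := {
  alg_norm : A -> K ;
  alg_normD : forall a b : A, alg_norm (a + b) <= alg_norm a + alg_norm b ;
  alg_normZ : forall (k : K) (a : A), alg_norm (k *: a) = `|k| * alg_norm a ;
  alg_norm0_eq0 : forall a : A, alg_norm a = 0 -> a = 0 ;
  alg_normM : forall a b : A, alg_norm (a * b) <= alg_norm a * alg_norm b ;
  alg_norm1 : alg_norm 1 = 1
}.

#[short(type="unitalNormedAlgType")]
HB.structure Definition UnitalNormedAlgebra (K : numFieldType) :=
  {A of GRing.UnitAlgebra K A & UnitAlgebra_isUnitalNormed K A}.

#[non_forgetful_inheritance]
HB.instance Definition _ (K : numFieldType) (A : unitalNormedAlgType K) :=
  Lmodule_isNormed.Build K (UnitalNormedAlgebra.sort A)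
    (@alg_normD K A) (@alg_normZ K A) (@alg_norm0_eq0 K A).

Definition norm_complete (K : numFieldType) (A : unitalNormedAlgType K) :=
  forall F : set_system A, ProperFilter F -> cauchy F -> cvg F.

HB.mixin Record UnitalNormedAlgebra_isComplete (K : numFieldType) A
    & UnitalNormedAlgebra K A := {
  banach_complete : norm_complete A
}.

#[short(type="unitalBanachAlgType")]
HB.structure Definition UnitalBanachAlgebra (K : numFieldType) :=
  {A of UnitalNormedAlgebra K A & UnitalNormedAlgebra_isComplete K A}.

#[non_forgetful_inheritance]
HB.instance Definition _ (K : numFieldType) (A : unitalBanachAlgType K) :=
  NormedModule.copy (UnitalBanachAlgebra.sort A) (A : unitalNormedAlgType K).
#[non_forgetful_inheritance]
HB.instance Definition _ (K : numFieldType) (A : unitalBanachAlgType K) :=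
  Uniform_isComplete.Build (UnitalBanachAlgebra.sort A) (@banach_complete K A).

Definition stable_rank_one (K : numFieldType) (A : unitalBanachAlgType K) :=
  dense [set a : A | a \is a GRing.unit].

(* Classically every ring has a [unitRingType] structure, whose units are
   exactly its two-sided invertible elements. *)
HB.factory Record NzRing_classicalInverse A & GRing.NzRing A := {}.

HB.builders Context A & NzRing_classicalInverse A.

Let invertible : pred A := [pred x | `[< exists y, y * x = 1 /\ x * y = 1 >]].

Let inv (x : A) : A :=
  if pselect (exists y, y * x = 1 /\ x * y = 1) is left h
  then projT1 (cid h) else x.

Let mulVr : {in invertible, left_inverse 1 inv *%R}.
Proof.
move=> x; rewrite unfold_in => /asboolP h; rewrite /inv; case: pselect => // h'.
by case: cid => y [].
Qed.

Let divrr : {in invertible, right_inverse 1 inv *%R}.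
Proof.
move=> x; rewrite unfold_in => /asboolP h; rewrite /inv; case: pselect => // h'.
by case: cid => y [].
Qed.

Let unitrP (x y : A) : y * x = 1 /\ x * y = 1 -> invertible x.
Proof. by move=> h; apply/asboolP; exists y. Qed.

Let invr_out : {in [predC invertible], inv =1 id}.
Proof.
move=> x hx; rewrite /inv; case: pselect => // h.
by have /negP[] : ~~ invertible x by []; apply/asboolP.
Qed.

HB.instance Definition _ :=
  GRing.NzRing_hasMulInverse.Build A mulVr divrr unitrP invr_out.

HB.end.

(* In a normed module over R[i] the norm is an R[i]-valued function taking
   nonnegative real values; [rnorm] is the same norm with values in R. *)
Definition rnorm (R : realType) (V : normedZmodType R[i]) (v : V) : R :=
  complex.Re `|v|.

Lemma ge0_complexE (R : realType) (z : R[i]) : 0 <= z -> z = (complex.Re z)%:C.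
Proof. by case: z => a b; rewrite lecE /= => /andP[/eqP -> _]. Qed.

Section rnorm_theory.
Context {R : realType} {V : normedZmodType R[i]}.
Implicit Types v w : V.

Lemma normE v : `|v| = (rnorm v)%:C.
Proof. exact/ge0_complexE/normr_ge0. Qed.

Lemma rnorm_ge0 v : 0 <= rnorm v.
Proof. by rewrite -lecR -normE; exact: normr_ge0. Qed.

Lemma rnorm0 : rnorm (0 : V) = 0.
Proof. by rewrite /rnorm normr0. Qed.

Lemma rnorm_eq0 v : rnorm v = 0 -> v = 0.
Proof. by move=> h; apply/normr0_eq0; rewrite normE h. Qed.

Lemma rnormD v w : rnorm (v + w) <= rnorm v + rnorm w.
Proof. by rewrite -lecR rmorphD /= -!normE ler_normD. Qed.

Lemma rnormN v : rnorm (- v) = rnorm v.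
Proof. by rewrite /rnorm normrN. Qed.

Lemma rdistC v w : rnorm (v - w) = rnorm (w - v).
Proof. by rewrite -rnormN opprB. Qed.

Lemma rdistD u v w : rnorm (v - w) <= rnorm (v - u) + rnorm (u - w).
Proof. by rewrite -[v - w](subrKA u) rnormD. Qed.

End rnorm_theory.

Section rnorm_alg.
Context {R : realType}.

Lemma Re_norm_ge0 (z : R[i]) : 0 <= complex.Re `|z|.
Proof. by rewrite -lecR -ge0_complexE//; exact: normr_ge0. Qed.

Lemma rnormZ (V : normedModType R[i]) (k : R[i]) (v : V) :
  rnorm (k *: v) = complex.Re `|k| * rnorm v.
Proof.
apply: (@complexI R); rewrite rmorphM /= -normE normrZ normE.
by rewrite -[in RHS]ge0_complexE.
Qed.

Lemma rnormM (A : unitalBanachAlgType R[i]) (a b : A) :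
  rnorm (a * b) <= rnorm a * rnorm b.
Proof. by rewrite -lecR rmorphM /= -!normE; exact: alg_normM. Qed.

Lemma rnorm1 (A : unitalBanachAlgType R[i]) : rnorm (1 : A) = 1.
Proof. by rewrite /rnorm [`|_|]alg_norm1. Qed.

End rnorm_alg.

Section complex_cvg.
Context {R : realType}.

Lemma gt0_complexE (e : R[i]) : 0 < e -> e = (complex.Re e)%:C.
Proof. by move=> /ltW/ge0_complexE. Qed.

Lemma gt0_Re (e : R[i]) : 0 < e -> 0 < complex.Re e.
Proof. by case: e => a b; rewrite ltcE /= => /andP[]. Qed.

Lemma ballE (V : normedModType R[i]) (x y : V) (e : R) :
  ball x e%:C y <-> rnorm (x - y) < e.
Proof. by rewrite -ball_normE /= normE ltcR. Qed.

Lemma cvgseqE (V : normedModType R[i]) (u : nat -> V) (l : V) :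
  u @ \oo --> l <->
  forall e : R, 0 < e -> exists N, forall n, (N <= n)%N -> rnorm (u n - l) < e.
Proof.
split=> [/cvgrPdist_lt h e e0|h].
  have e0' : (0 : R[i]) < e%:C by rewrite ltcR.
  have [N _ hN] := h _ e0'; exists N => n Nn.
  by rewrite rdistC -ltcR -normE; apply: hN.
apply/cvgrPdist_lt => e e0; have [N hN] := h _ (gt0_Re e0).
exists N => // n /= Nn; rewrite (gt0_complexE e0) normE ltcR rdistC.
exact: hN.
Qed.

Lemma geo_small (C e : R) : 0 <= C -> 0 < e ->
  exists n, C * 2^-1 ^+ n < e.
Proof.
move=> C0 e0; have [->|CN0] := eqVneq C 0; first by exists 0; rewrite mul0r.
have {C0 CN0} C0 : 0 < C by rewrite lt0r CN0.
have h : (2^-1 : R) ^+ n @[n --> \oo] --> 0.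
  by apply: cvg_expr; rewrite ger0_norm// invf_lt1// ltr1n.
have /cvgrPdist_lt/(_ _ (divr_gt0 e0 C0))[N _ hN] := h.
exists N; rewrite mulrC -ltr_pdivlMr//.
by have := hN N (leqnn _); rewrite /= sub0r normrN ger0_norm.
Qed.

Lemma geo_dist (V : normedModType R[i]) (u : nat -> V) (C : R) :
  (forall n, rnorm (u n.+1 - u n) <= C * 2^-1 ^+ n) ->
  forall n m, (n <= m)%N -> rnorm (u m - u n) <= C * 2 * 2^-1 ^+ n.
Proof.
move=> h n m /subnKC <-; move: (m - n)%N => k {m}.
have C0 : 0 <= C by have := le_trans (rnorm_ge0 _) (h 0%N); rewrite mulr1.
suff H : rnorm (u (n + k)%N - u n) <= C * 2 * (2^-1 ^+ n - 2^-1 ^+ (n + k)).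
  apply: le_trans H _; rewrite ler_wpM2l ?mulr_ge0// lerBlDr lerDl.
  by rewrite exprn_ge0// invr_ge0.
elim: k => [|k IH]; first by rewrite addn0 !subrr rnorm0 mulr0.
apply: le_trans (rdistD (u (n + k)%N) _ _) _.
rewrite addnS; apply: le_trans (lerD (h _) IH) _.
rewrite exprS le_eqVlt; apply/orP; left; apply/eqP.
by field.
Qed.

Lemma geo_cvg (V : completeNormedModType R[i]) (u : nat -> V) (C : R) :
  (forall n, rnorm (u n.+1 - u n) <= C * 2^-1 ^+ n) ->
  exists l, forall n, rnorm (u n - l) <= C * 2 * 2^-1 ^+ n.
Proof.
move=> h.
have C0 : 0 <= C by have := le_trans (rnorm_ge0 _) (h 0%N); rewrite mulr1.
have D := geo_dist h.
have cu : cvg (u @ \oo).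
  apply: cauchy_cvg; apply: cauchy_exP => e e0.
  have [N hN] := @geo_small (C * 2) _ (mulr_ge0 C0 (ler0n R 2)) (gt0_Re e0).
  exists (u N); exists N => // n /= Nn.
  rewrite (gt0_complexE e0); apply/ballE; rewrite rdistC.
  exact: le_lt_trans (D _ _ Nn) hN.
have /cvgseqE hl : u @ \oo --> lim (u @ \oo) by [].
exists (lim (u @ \oo)) => n; apply/ler_addgt0Pr => e e0.
have [N hN] := hl _ e0.
apply: le_trans (rdistD (u (maxn n N)) _ _) _.
apply: lerD; first by rewrite rdistC; apply: D; exact: leq_maxl.
by apply/ltW/hN; exact: leq_maxr.
Qed.

Lemma geo_complete (V : normedModType R[i]) :
  (forall u : nat -> V, (forall n, rnorm (u n.+1 - u n) <= 2^-1 ^+ n) ->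
    exists l (C : R), forall n, rnorm (u n - l) <= C * 2^-1 ^+ n) ->
  forall F : set_system V, ProperFilter F -> cauchy F -> cvg F.
Proof.
move=> H F FF /cauchyP Fc.
have g0 n : 0 < (2^-1 : R) ^+ n by rewrite exprn_gt0// invr_gt0.
have /choice[u hu] : forall n : nat, exists x : V, F (ball x ((2^-1 : R) ^+ n.+2)%:C).
  by move=> n; apply: Fc; rewrite ltcR.
have [|l [C hl]] := H u.
  move=> n; have [z [/ballE z1 /ballE z2]] := filter_ex (filterI (hu n.+1) (hu n)).
  apply: le_trans (rdistD z _ _) _; rewrite [rnorm (z - _)]rdistC.
  apply: le_trans (lerD (ltW z1) (ltW z2)) _.
  rewrite !exprS -subr_ge0.
  set t := _ ^+ n; have -> : t - (2^-1 * (2^-1 * (2^-1 * t)) + 2^-1 * (2^-1 * t))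
    = t * (5%:R / 8%:R) by field.
  by rewrite mulr_ge0// ltW// g0.
have C0 : 0 <= C by have := le_trans (rnorm_ge0 _) (hl 0%N); rewrite mulr1.
apply/cvg_ex; exists l; apply/cvg_ballP => e e0.
have [n hn] := @geo_small (C + 1) _ (addr_ge0 C0 ler01) (gt0_Re e0).
apply: filterS (hu n) => z /ballE hz; rewrite (gt0_complexE e0).
apply/ballE; apply: le_lt_trans (rdistD (u n) _ _) _; rewrite rdistC.
apply: le_lt_trans hn; rewrite mulrDl; apply: lerD; first exact: hl.
apply: le_trans (ltW hz) _; rewrite mul1r; apply: ler_wiXn2l => //.
- by rewrite invf_le1 // ler1n.
- by rewrite ltnW // ltnW.
Qed.

End complex_cvg.

Section linfty_def.
Context {R : realType} (A : unitalBanachAlgType R[i]).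

Definition linfty_pred : pred (nat -> A) := [pred x | `[< bounded_fun x >]].

Record linfty := Linfty {
  linfty_seq :> nat -> A ;
  linfty_seqP : linfty_seq \in linfty_pred }.

HB.instance Definition _ := [isSub for linfty_seq].
HB.instance Definition _ := [Choice of linfty by <:].

Lemma linfty_predP (x : nat -> A) :
  reflect (exists M : R, forall n, rnorm (x n) <= M) (x \in linfty_pred).
Proof.
apply: (iffP (asboolP _)) => [[M [_ hM]]|[M hM]].
  have hM' : M < M + 1 by rewrite ltrDl.
  exists (complex.Re (M + 1)) => n; have := hM _ hM' n I => /=.
  by rewrite /rnorm lecE => /andP[].
exists M%:C; split=> [|N MN n _ /=]; first by rewrite complex_real.
by rewrite (le_trans _ (ltW MN))// normE lecR.
Qed.

Lemma linfty_bounded (x : linfty) : exists M : R, forall n, rnorm (x n) <= M.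
Proof. exact/linfty_predP/linfty_seqP. Qed.

Fact linfty_subring_closed : subring_closed linfty_pred.
Proof.
split=> [|x y /linfty_predP[M hM] /linfty_predP[N hN]|
          x y /linfty_predP[M hM] /linfty_predP[N hN]]; apply/linfty_predP.
- by exists (rnorm (1 : A)).
- exists (M + N) => n; apply: le_trans (rnormD _ _) _.
  by rewrite rnormN lerD.
- exists (M * N) => n; apply: le_trans (rnormM _ _) _.
  by rewrite ler_pM// rnorm_ge0.
Qed.

Fact linfty_scaler_closed : scaler_closed linfty_pred.
Proof.
move=> k x /linfty_predP[M hM]; apply/linfty_predP.
by exists (complex.Re `|k| * M) => n; rewrite rnormZ ler_wpM2l// Re_norm_ge0.
Qed.

HB.instance Definition _ :=
  GRing.isSubringClosed.Build (nat -> A) linfty_pred linfty_subring_closed.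
HB.instance Definition _ :=
  GRing.isScaleClosed.Build R[i] (nat -> A) linfty_pred linfty_scaler_closed.
HB.instance Definition _ :=
  [SubChoice_isSubNzRing of linfty by <:].
HB.instance Definition _ :=
  [SubZmodule_isSubLmodule of linfty by <:].

Fact linfty_scalerAl (k : R[i]) (x y : linfty) : k *: (x * y) = k *: x * y.
Proof. by apply/val_inj/funext => n /=; exact: scalerAl. Qed.
HB.instance Definition _ :=
  GRing.Lmodule_isLalgebra.Build R[i] linfty linfty_scalerAl.

Fact linfty_scalerAr (k : R[i]) (x y : linfty) : k *: (x * y) = x * (k *: y).
Proof. by apply/val_inj/funext => n /=; exact: scalerAr. Qed.
HB.instance Definition _ :=
  GRing.Lalgebra_isAlgebra.Build R[i] linfty linfty_scalerAr.

HB.instance Definition _ := NzRing_classicalInverse.Build linfty.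

Definition linfty_norm (x : linfty) : R[i] :=
  (sup [set rnorm (x n) | n in [set: nat]])%:C.

End linfty_def.

Section linfty_banach.
Context {R : realType} {A : unitalBanachAlgType R[i]}.
Implicit Types x y : linfty A.

Let S x : set R := [set rnorm (x n) | n in [set: nat]].

Let has_sup_S x : has_sup (S x).
Proof.
split; first by exists (rnorm (x 0%N)); exists 0%N.
by have [M hM] := linfty_bounded x; exists M => _ [n _ <-].
Qed.

Let supS_ub x n : rnorm (x n) <= sup (S x).
Proof. by apply: ub_le_sup; [case: (has_sup_S x)|exists n]. Qed.

Let supS_lub x (M : R) : (forall n, rnorm (x n) <= M) -> sup (S x) <= M.
Proof.
move=> h; apply: ge_sup; first by case: (has_sup_S x).
by move=> _ [n _ <-].
Qed.

Fact linfty_normD x y : linfty_norm (x + y) <= linfty_norm x + linfty_norm y.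
Proof.
rewrite /linfty_norm -rmorphD lecR; apply: supS_lub => n.
by apply: le_trans (rnormD _ _) _; apply: lerD; exact: supS_ub.
Qed.

Fact linfty_normZ (k : R[i]) x : linfty_norm (k *: x) = `|k| * linfty_norm x.
Proof.
rewrite /linfty_norm [`|k|]ge0_complexE// -rmorphM; congr (_%:C).
apply/eqP; rewrite eq_le; apply/andP; split.
  apply: supS_lub => n; rewrite rnormZ ler_wpM2l ?Re_norm_ge0//.
  exact: supS_ub.
have [->|k0] := eqVneq k 0.
  by rewrite normr0 mul0r; apply: le_trans (supS_ub _ 0%N); exact: rnorm_ge0.
have k1 : 0 < complex.Re `|k| by apply/gt0_Re; rewrite normr_gt0.
rewrite mulrC -ler_pdivlMr//; apply: supS_lub => n.
by rewrite ler_pdivlMr// mulrC -rnormZ; exact: (supS_ub (k *: x)).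
Qed.

Fact linfty_norm0_eq0 x : linfty_norm x = 0 -> x = 0.
Proof.
move=> /complexI h; apply/val_inj/funext => n /=; apply: rnorm_eq0.
by apply/eqP; rewrite eq_le rnorm_ge0 andbT -h; exact: supS_ub.
Qed.

Fact linfty_normM x y : linfty_norm (x * y) <= linfty_norm x * linfty_norm y.
Proof.
rewrite /linfty_norm -rmorphM lecR; apply: supS_lub => n.
apply: le_trans (rnormM _ _) _.
by rewrite ler_pM ?rnorm_ge0//; exact: supS_ub.
Qed.

Fact linfty_norm1 : linfty_norm (1 : linfty A) = 1.
Proof.
rewrite /linfty_norm; congr (_%:C); apply/eqP; rewrite eq_le; apply/andP; split.
  by apply: supS_lub => n; rewrite rnorm1.
by apply: le_trans (supS_ub _ 0%N); rewrite rnorm1.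
Qed.

HB.instance Definition _ := UnitAlgebra_isUnitalNormed.Build R[i] (linfty A)
  linfty_normD linfty_normZ linfty_norm0_eq0 linfty_normM linfty_norm1.
HB.instance Definition _ := NormedModule.copy (linfty A)
  (linfty A : unitalNormedAlgType R[i]).

Lemma linfty_rnormE x : rnorm x = sup [set rnorm (x n) | n in [set: nat]].
Proof. by []. Qed.

Lemma linfty_rnorm_ub x n : rnorm (x n) <= rnorm x.
Proof. exact: supS_ub. Qed.

Lemma linfty_rnorm_lub x (M : R) : (forall n, rnorm (x n) <= M) -> rnorm x <= M.
Proof. exact: supS_lub. Qed.

Fact linfty_complete (F : set_system (linfty A)) :
  ProperFilter F -> cauchy F -> cvg F.
Proof.
move: F; apply: geo_complete => u hu.
have hk k : exists l : A, forall n, rnorm (u n k - l) <= 1 * 2 * 2^-1 ^+ n.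
  apply: geo_cvg => n; rewrite mul1r; apply: le_trans (hu n).
  exact: (linfty_rnorm_ub (u n.+1 - u n) k).
have [l hl] := choice hk.
have lP : l \in @linfty_pred R A.
  have [M hM] := linfty_bounded (u 0%N).
  apply/linfty_predP; exists (1 * 2 * 1 + M) => n.
  rewrite -[l n](subrK (u 0%N n)); apply: le_trans (rnormD _ _) _.
  by apply: lerD => //; rewrite rdistC; exact: hl.
exists (Linfty lP), (1 * 2) => n; apply: linfty_rnorm_lub => k.
exact: hl.
Qed.

HB.instance Definition _ := UnitalNormedAlgebra_isComplete.Build R[i] (linfty A)
  linfty_complete.
HB.instance Definition _ :=
  Uniform_isComplete.Build (linfty A) linfty_complete.

End linfty_banach.

Section asy_def.
Context {R : realType} (A : unitalBanachAlgType R[i]).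

Definition c0 : pred (linfty A) :=
  [pred x : linfty A | `[< (x : nat -> A) @ \oo --> (0 : A) >]].

Lemma c0P (x : linfty A) :
  reflect (forall e : R, 0 < e -> exists N, forall n, (N <= n)%N -> rnorm (x n) < e)
          (x \in c0).
Proof.
apply: (iffP (asboolP _)) => [/cvgseqE h e /h[N hN]|h].
  by exists N => n /hN; rewrite subr0.
by apply/cvgseqE => e /h[N hN]; exists N => n /hN; rewrite subr0.
Qed.

Fact c0_zmod_closed : zmod_closed c0.
Proof.
split=> [|x y /c0P hx /c0P hy]; apply/c0P => e e0.
  by exists 0%N => n _; rewrite rnorm0.
have e2 : 0 < e / 2 by rewrite divr_gt0.
have [[N hN] [M hM]] := (hx _ e2, hy _ e2).
exists (maxn N M) => n; rewrite geq_max => /andP[/hN Nn /hM Mn].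
apply: le_lt_trans (rnormD _ _) _; rewrite rnormN (splitr e).
exact: ltrD.
Qed.

HB.instance Definition _ := GRing.isZmodClosed.Build (linfty A) c0 c0_zmod_closed.

Fact c0Ml (x y : linfty A) : y \in c0 -> x * y \in c0.
Proof.
move=> /c0P hy; apply/c0P => e e0.
have d0 : 0 < rnorm x + 1 by rewrite ltr_wpDl// rnorm_ge0.
have [N hN] := hy _ (divr_gt0 e0 d0); exists N => n /hN yn.
apply: le_lt_trans (rnormM _ _) _.
apply: (@le_lt_trans _ _ ((rnorm x + 1) * rnorm (y n))).
  rewrite ler_wpM2r ?rnorm_ge0//.
  by apply: le_trans (linfty_rnorm_ub x n) _; rewrite lerDl.
by rewrite mulrC -ltr_pdivlMr.
Qed.

Fact c0Mr (x y : linfty A) : x \in c0 -> x * y \in c0.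
Proof.
move=> /c0P hx; apply/c0P => e e0.
have d0 : 0 < rnorm y + 1 by rewrite ltr_wpDl// rnorm_ge0.
have [N hN] := hx _ (divr_gt0 e0 d0); exists N => n /hN xn.
apply: le_lt_trans (rnormM _ _) _.
apply: (@le_lt_trans _ _ (rnorm (x n) * (rnorm y + 1))).
  rewrite ler_wpM2l ?rnorm_ge0//.
  by apply: le_trans (linfty_rnorm_ub y n) _; rewrite lerDl.
by rewrite -ltr_pdivlMr.
Qed.

Fact c0Z (k : R[i]) (x : linfty A) : x \in c0 -> k *: x \in c0.
Proof. by move=> hx; rewrite -[x]mul1r scalerAl; exact: c0Ml. Qed.

Fact one_notin_c0 : (1 : linfty A) \notin c0.
Proof.
apply/negP => /c0P/(_ 1 ltr01)[N /(_ N (leqnn N))].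
by rewrite rnorm1 ltxx.
Qed.

Fact c0_closed (x : linfty A) :
  (forall e : R, 0 < e -> exists2 y, y \in c0 & rnorm (x - y) < e) -> x \in c0.
Proof.
move=> h; apply/c0P => e e0; have e2 : 0 < e / 2 by rewrite divr_gt0.
have [y /c0P/(_ _ e2)[N hN] xy] := h _ e2; exists N => n /hN yn.
rewrite -[x n](subrK (y n)) (splitr e); apply: le_lt_trans (rnormD _ _) _.
by apply: ltrD => //; apply: le_lt_trans xy; exact: (linfty_rnorm_ub (x - y)).
Qed.

Definition asy : Type :=
  {ideal_quot (GRing.ZmodClosed.clone (linfty A) c0 _)}.

HB.instance Definition _ := EqQuotient.on asy.
HB.instance Definition _ := GRing.Zmodule.on asy.
HB.instance Definition _ := ZmodQuotient.on asy.

Local Notation pi := (\pi_asy : linfty A -> asy).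

Lemma asy_eqP (x y : linfty A) : (pi x = pi y) <-> (x - y \in c0).
Proof. by rewrite Quotient.idealrBE; split=> /eqP. Qed.

Lemma asy_ind (P : asy -> Prop) : (forall x, P (pi x)) -> forall q, P q.
Proof. by move=> h q; rewrite -[q]reprK. Qed.

Definition asy_one : asy := pi 1.
Definition asy_mul (p q : asy) : asy := pi (repr p * repr q).
Definition asy_scale (k : R[i]) (q : asy) : asy := pi (k *: repr q).

Lemma asy_reprE (x : linfty A) : repr (pi x) - x \in c0.
Proof. by apply/asy_eqP; rewrite reprK. Qed.

Lemma asy_mulE x y : asy_mul (pi x) (pi y) = pi (x * y).
Proof.
apply/asy_eqP; rewrite -[X in X - _](subrK (x * repr (pi y))) -mulrBl -addrA.
rewrite -mulrBr rpredD//; first by apply: c0Mr; exact: asy_reprE.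
by apply: c0Ml; exact: asy_reprE.
Qed.

Lemma asy_scaleE k x : asy_scale k (pi x) = pi (k *: x).
Proof. by apply/asy_eqP; rewrite -scalerBr; apply: c0Z; exact: asy_reprE. Qed.

Lemma asy_addE x y : pi x + pi y = pi (x + y).
Proof. by apply/esym; exact: pi_addr. Qed.

Fact asy_mulA : associative asy_mul.
Proof.
by elim/asy_ind=> x; elim/asy_ind=> y; elim/asy_ind=> z; rewrite !asy_mulE mulrA.
Qed.

Fact asy_mul1 : left_id asy_one asy_mul.
Proof. by elim/asy_ind=> x; rewrite asy_mulE mul1r. Qed.

Fact asy_mulr1 : right_id asy_one asy_mul.
Proof. by elim/asy_ind=> x; rewrite asy_mulE mulr1. Qed.

Fact asy_mulDl : left_distributive asy_mul +%R.
Proof.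
elim/asy_ind=> x; elim/asy_ind=> y; elim/asy_ind=> z.
by rewrite asy_addE !asy_mulE asy_addE mulrDl.
Qed.

Fact asy_mulDr : right_distributive asy_mul +%R.
Proof.
elim/asy_ind=> x; elim/asy_ind=> y; elim/asy_ind=> z.
by rewrite asy_addE !asy_mulE asy_addE mulrDr.
Qed.

Fact asy_one_neq0 : asy_one != 0.
Proof.
apply/eqP; rewrite -[0 : asy](@pi_zeror _ _ _ _ _ asy) => /asy_eqP.
by rewrite subr0; exact/negP/one_notin_c0.
Qed.

HB.instance Definition _ := GRing.Zmodule_isNzRing.Build asy
  asy_mulA asy_mul1 asy_mulr1 asy_mulDl asy_mulDr asy_one_neq0.

Fact asy_scalerA a b q : asy_scale a (asy_scale b q) = asy_scale (a * b) q.
Proof. by elim/asy_ind: q => x; rewrite !asy_scaleE scalerA. Qed.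

Fact asy_scale1 : left_id 1 asy_scale.
Proof. by elim/asy_ind=> x; rewrite asy_scaleE scale1r. Qed.

Fact asy_scaleDr : right_distributive asy_scale +%R.
Proof.
move=> k; elim/asy_ind=> x; elim/asy_ind=> y.
by rewrite asy_addE !asy_scaleE asy_addE scalerDr.
Qed.

Fact asy_scaleDl q : {morph asy_scale^~ q : a b / a + b}.
Proof.
by elim/asy_ind: q => x a b; rewrite !asy_scaleE asy_addE scalerDl.
Qed.

HB.instance Definition _ := GRing.Zmodule_isLmodule.Build R[i] asy
  asy_scalerA asy_scale1 asy_scaleDr asy_scaleDl.

Fact asy_scalerAl (k : R[i]) (p q : asy) : k *: (p * q) = k *: p * q.
Proof.
elim/asy_ind: p => x; elim/asy_ind: q => y.
rewrite /GRing.scale /GRing.mul /= asy_mulE !asy_scaleE asy_mulE.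
by rewrite scalerAl.
Qed.
HB.instance Definition _ :=
  GRing.Lmodule_isLalgebra.Build R[i] asy asy_scalerAl.

Fact asy_scalerAr (k : R[i]) (p q : asy) : k *: (p * q) = p * (k *: q).
Proof.
elim/asy_ind: p => x; elim/asy_ind: q => y.
rewrite /GRing.scale /GRing.mul /= asy_mulE !asy_scaleE asy_mulE.
by rewrite scalerAr.
Qed.
HB.instance Definition _ :=
  GRing.Lalgebra_isAlgebra.Build R[i] asy asy_scalerAr.

HB.instance Definition _ := NzRing_classicalInverse.Build asy.

Definition asy_norm (q : asy) : R[i] :=
  (inf [set rnorm x | x in [set x : linfty A | \pi_asy x = q]])%:C.

End asy_def.

Section asy_banach.
Context {R : realType} {A : unitalBanachAlgType R[i]}.
Implicit Types (x y : linfty A) (p q : asy A).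

Let S q : set R := [set rnorm x | x in [set x : linfty A | \pi_(asy A) x = q]].

Let S0 q : S q !=set0.
Proof. by exists (rnorm (repr q)); exists (repr q) => //=; rewrite reprK. Qed.

Let Slb q : has_lbound (S q).
Proof. by exists 0 => _ [x _ <-]; exact: rnorm_ge0. Qed.

Let infS_le q x : \pi x = q -> inf (S q) <= rnorm x.
Proof. by move=> xq; apply: ge_inf; [exact: Slb|exists x]. Qed.

Let infS_ge q (M : R) :
  (forall x, \pi x = q -> M <= rnorm x) -> M <= inf (S q).
Proof. by move=> h; apply: lb_le_inf; [exact: S0|move=> _ [x xq <-]; exact: h]. Qed.

Let infS_adh q (e : R) : 0 < e -> exists2 x, \pi x = q & rnorm x < inf (S q) + e.
Proof.
move=> e0; have [_ [x xq <-] h] := inf_adherent e0 (conj (S0 q) (Slb q)).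
by exists x.
Qed.

Fact asy_normD p q : asy_norm (p + q) <= asy_norm p + asy_norm q.
Proof.
rewrite /asy_norm -rmorphD lecR; apply/ler_addgt0Pr => e e0.
have e2 : 0 < e / 2 by rewrite divr_gt0.
have [x xp hx] := infS_adh p e2; have [y yq hy] := infS_adh q e2.
apply: le_trans (@infS_le _ (x + y) _) _; first by rewrite -asy_addE xp yq.
apply: le_trans (rnormD _ _) _; rewrite [e in leRHS]splitr addrACA.
by apply: lerD; exact: ltW.
Qed.

Fact asy_normZ (k : R[i]) q : asy_norm (k *: q) = `|k| * asy_norm q.
Proof.
rewrite /asy_norm [`|k|]ge0_complexE// -rmorphM; congr (_%:C).
have le1 (l : R[i]) p : inf (S (l *: p)) <= complex.Re `|l| * inf (S p).
  apply/ler_addgt0Pr => e e0.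
  have d0 : 0 < complex.Re `|l| + 1 by rewrite ltr_wpDl ?Re_norm_ge0.
  have [x xp hx] := infS_adh p (divr_gt0 e0 d0).
  apply: le_trans (@infS_le _ (l *: x) _) _; first by rewrite -asy_scaleE xp.
  rewrite rnormZ; apply: le_trans (ler_wpM2l (Re_norm_ge0 _) (ltW hx)) _.
  rewrite mulrDr lerD2l mulrCA -[leRHS]mulr1 ler_wpM2l ?(ltW e0)//.
  by rewrite ler_pdivrMr// mul1r lerDl.
apply/eqP; rewrite eq_le le1 andTb.
have [->|k0] := eqVneq k 0.
  by rewrite normr0 mul0r; apply: infS_ge => x _; exact: rnorm_ge0.
have k1 : 0 < complex.Re `|k| by apply/gt0_Re; rewrite normr_gt0.
have := le1 k^-1 (k *: q); rewrite scalerA mulVf// scale1r.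
rewrite normfV [X in X^-1]ge0_complexE// -fmorphV /=.
by rewrite mulrC ler_pdivlMr// mulrC.
Qed.

Fact asy_norm0_eq0 q : asy_norm q = 0 -> q = 0.
Proof.
move=> /complexI h; rewrite -[q]reprK -[0 : asy A](@pi_zeror _ _ _ _ _ (asy A)).
apply/asy_eqP; rewrite subr0; apply: c0_closed => e e0.
have [x xq hx] := infS_adh q e0.
exists (repr q - x); first by apply/asy_eqP; rewrite reprK xq.
by rewrite opprB addrCA subrr addr0; move: hx; rewrite h add0r.
Qed.

Fact asy_normM p q : asy_norm (p * q) <= asy_norm p * asy_norm q.
Proof.
rewrite /asy_norm -rmorphM lecR.
have H x y : \pi x = p -> \pi y = q -> inf (S (p * q)) <= rnorm x * rnorm y.
  move=> xp yq; apply: le_trans (@infS_le _ (x * y) _) (rnormM _ _).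
  by rewrite -asy_mulE xp yq.
have q0 : 0 <= inf (S q) by apply: infS_ge => x _; exact: rnorm_ge0.
have H2 y : \pi y = q -> inf (S (p * q)) <= inf (S p) * rnorm y.
  move=> yq; have [y0|y0] := eqVneq (rnorm y) 0.
    by have := H _ _ (reprK p) yq; rewrite y0 !mulr0.
  have {}y0 : 0 < rnorm y by rewrite lt0r y0 rnorm_ge0.
  rewrite -ler_pdivrMr//; apply: infS_ge => x xp.
  by rewrite ler_pdivrMr//; exact: H.
have p0 : 0 <= inf (S p) by apply: infS_ge => x _; exact: rnorm_ge0.
have [p1|p1] := eqVneq (inf (S p)) 0.
  by have := H2 _ (reprK q); rewrite p1 !mul0r.
have {}p0 : 0 < inf (S p) by rewrite lt0r p1.
rewrite mulrC -ler_pdivrMr//; apply: infS_ge => y yq.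
by rewrite ler_pdivrMr// mulrC; exact: H2.
Qed.

Fact asy_norm1 : asy_norm (1 : asy A) = 1.
Proof.
rewrite /asy_norm; congr (_%:C); apply/eqP; rewrite eq_le; apply/andP; split.
  by rewrite -(rnorm1 (linfty A)); exact: infS_le.
apply: infS_ge => x /asy_eqP/c0P hx; apply/ler_addgt0Pr => e e0.
have [N /(_ N (leqnn N)) hN] := hx _ e0.
rewrite -(rnorm1 A) -[1](subrK (x N)) addrC.
apply: le_trans (rnormD _ _) _; apply: lerD; first exact: linfty_rnorm_ub.
by rewrite rdistC; exact: ltW.
Qed.

HB.instance Definition _ := UnitAlgebra_isUnitalNormed.Build R[i] (asy A)
  asy_normD asy_normZ asy_norm0_eq0 asy_normM asy_norm1.
HB.instance Definition _ := NormedModule.copy (asy A)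
  (asy A : unitalNormedAlgType R[i]).

Fact asy_complete (F : set_system (asy A)) :
  ProperFilter F -> cauchy F -> cvg F.
Proof.
move: F; apply: geo_complete => u hu.
have g0 n : 0 < (2^-1 : R) ^+ n by rewrite exprn_gt0// invr_gt0.
have /choice[d hd] : forall n : nat, exists x,
    \pi_(asy A) x = u n.+1 - u n /\ rnorm x <= 2 * 2^-1 ^+ n.
  move=> n; have [x xu hx] := infS_adh (u n.+1 - u n) (g0 n).
  exists x; split=> //; apply: le_trans (ltW hx) _.
  by rewrite mulrDl mul1r; apply: lerD => //; exact: hu.
pose v := fix v n := if n is m.+1 then v m + d m else repr (u 0%N).
have vu n : \pi_(asy A) (v n) = u n.
  elim: n => [|n IH] /=; first by rewrite reprK.
  by rewrite -asy_addE IH (hd n).1 addrC subrK.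
have [n|l hl] := @geo_cvg _ _ v 2.
  by rewrite /= addrC addKr; exact: (hd n).2.
exists (\pi l), (2 * 2) => n; apply: le_trans (hl n).
apply: infS_le; rewrite -vu -asy_addE; congr (_ + _); exact: pi_oppr.
Qed.

HB.instance Definition _ := UnitalNormedAlgebra_isComplete.Build R[i] (asy A)
  asy_complete.
HB.instance Definition _ :=
  Uniform_isComplete.Build (asy A) asy_complete.

End asy_banach.

(* Main.v *)
(* If q is an invertible element of Asy(A) close to the class of the constant
   sequence a, then q lifts to a sequence x with every x_n close to a.  Lifting
   q^-1 to y, both x_n y_n and y_n x_n tend to 1, hence are eventually
   invertible by the Neumann series, and then so is x_n. *)
Require Import Defs.
From mathcomp Require Import all_boot all_order all_algebra.
From mathcomp Require Import all_classical all_reals all_analysis.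
From mathcomp Require Import complex.
Local Open Scope ring_scope.
Local Open Scope complex_scope.

Import Order.TTheory GRing.Theory Num.Theory.

(** [x] has right inverse [y * (x * y)^-1] and left inverse [(y * x)^-1 * y], and these must
    agree. *)
Lemma unitr_of_mul (U : unitRingType) (x y : U) :
  x * y \is a GRing.unit -> y * x \is a GRing.unit -> x \is a GRing.unit.
Proof.
move=> xyU yxU; apply/unitrP; exists (y * (x * y)^-1).
have r1 : x * (y * (x * y)^-1) = 1 by rewrite mulrA mulrV.
have l1 : (y * x)^-1 * y * x = 1 by rewrite -mulrA mulVr.
suff E : y * (x * y)^-1 = (y * x)^-1 * y by split; rewrite // E.
by rewrite -[LHS]mul1r -l1 -mulrA r1 mulr1.
Qed.

Section Neumann.
Context {R : realType} {A : unitalBanachAlgType R[i]}.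

Lemma rnormX_geo (c : A) (r : R) :
  rnorm c <= r -> forall n, rnorm (c ^+ n) <= r ^+ n.
Proof.
move=> hc; elim=> [|n IH]; first by rewrite !expr0 rnorm1.
by rewrite !exprS (le_trans (rnormM _ _))// ler_pM ?rnorm_ge0.
Qed.

(** Lets the inverse identities below follow from geometric error bounds, without continuity of
    multiplication. *)
Lemma geo_eq0 (z : A) (C : R) : (forall n, rnorm z <= C * 2^-1 ^+ n) -> z = 0.
Proof.
move=> hz; apply: rnorm_eq0; apply/eqP; rewrite eq_le rnorm_ge0 andbT.
have C0 : 0 <= C by have := le_trans (rnorm_ge0 _) (hz 0%N); rewrite mulr1.
apply/ler_addgt0Pr => e e0; rewrite add0r.
have [n hn] := @geo_small R C e C0 e0.
exact: le_trans (hz n) (ltW hn).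
Qed.

(** The inverse is the limit [l] of the Neumann partial sums [u n]. The bound [2^-1] matches the
    ratio in [geo_cvg]. *)
Lemma unitr_1B (c : A) : rnorm c <= 2^-1 -> 1 - c \is a GRing.unit.
Proof.
move=> hc; pose u n : A := \sum_(i < n) c ^+ i.
have hX := @rnormX_geo c _ hc.
have du n : u n.+1 - u n = c ^+ n.
  by rewrite /u big_ord_recr /= [X in X - _]addrC addrK.
have [l hl] : exists l : A, forall n, rnorm (u n - l) <= 1 * 2 * 2^-1 ^+ n.
  apply: (@geo_cvg R A u 1) => n; rewrite mul1r.
  by apply: le_trans (hX n); rewrite -du.
have ur n : (1 - c) * u n = 1 - c ^+ n by rewrite -opprB mulNr -subrX1 opprB.
have ul n : u n * (1 - c) = 1 - c ^+ n.
  rewrite -ur; apply: commr_sym; apply: commr_sum => i _.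
  by apply/commr_sym/commrB; [exact: commr1|apply/commr_sym/commrX].
(* To be used with [z] equal to [l * (1 - c)] and [(1 - c) * l]; the summand [1] in the constant
   absorbs [c ^+ n]. *)
have err n (z : A) :
    rnorm (1 - c ^+ n - z) <= 1 * 2 * 2^-1 ^+ n * rnorm (1 - c) ->
    rnorm (z - 1) <= (2 * rnorm (1 - c) + 1) * 2^-1 ^+ n.
  rewrite mul1r => hz; apply: le_trans (rdistD (1 - c ^+ n) _ _) _.
  rewrite mulrDl mul1r mulrAC; apply: lerD; first by rewrite rdistC.
  by rewrite addrAC subrr add0r rnormN.
apply/unitrP; exists l; split; apply/subr0_eq;
  apply: (@geo_eq0 _ (2 * rnorm (1 - c) + 1)) => n; apply: err.
- rewrite -ul -mulrBl; apply: le_trans (rnormM _ _) _.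
  by rewrite ler_wpM2r ?rnorm_ge0.
- rewrite -ur -mulrBr; apply: le_trans (rnormM _ _) _.
  by rewrite mulrC ler_wpM2r ?rnorm_ge0.
Qed.

End Neumann.

(** The quotient norm is an infimum over lifts, so the difference of the two classes has a lift [z]
    of norm below [e]; then [y] is [x - z]. *)
Lemma asy_lift_dist (R : realType) (A : unitalBanachAlgType R[i])
    (x : linfty A) (q : asy A) (e : R) :
  rnorm (\pi_(asy A)%qT x - q) < e ->
  exists2 y, \pi_(asy A)%qT y = q & rnorm (x - y) < e.
Proof.
move=> h; set p := _ - q in h.
have [|_ [z /= zp <-] hz] := @inf_lt R
  [set rnorm z | z in [set z : linfty A | \pi_(asy A)%qT z = p]]%classic e _ h.
  by exists (rnorm (repr p)), (repr p) => //=; rewrite reprK.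
exists (x - z); last by rewrite opprB addrC subrK.
have -> : q = \pi_(asy A)%qT x - p by rewrite /p opprB addrC subrK.
by apply: (addIr p); rewrite subrK -[p in LHS]zp asy_addE subrK.
Qed.

Lemma asy_mul_eq1_eventually (R : realType) (A : unitalBanachAlgType R[i])
    (x y : linfty A) : \pi_(asy A)%qT x * \pi_(asy A)%qT y = 1 ->
  exists N, forall n, (N <= n)%N -> x n * y n \is a GRing.unit.
Proof.
(* The equation is reversed to put [1 - x * y] in [c0]; its terms serve as [c] in [unitr_1B]. *)
rewrite [LHS]asy_mulE => /esym/asy_eqP/c0P/(_ 2^-1).
case=> [|N hN]; first by rewrite invr_gt0.
by exists N => n /hN/ltW/unitr_1B; rewrite /= opprB addrC subrK.
Qed.

Lemma asy_unit_exists (R : realType) (A : unitalBanachAlgType R[i])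
    (x : linfty A) :
  \pi_(asy A)%qT x \is a GRing.unit -> exists n, x n \is a GRing.unit.
Proof.
move=> /unitrP[q]; rewrite -[q]reprK.
move=> -[/asy_mul_eq1_eventually[N hN] /asy_mul_eq1_eventually[M hM]].
(* Past both thresholds the two products are invertible at the same index. *)
exists (maxn N M); apply: (@unitr_of_mul _ _ (repr q (maxn N M))).
- exact/hM/leq_maxr.
- exact/hN/leq_maxl.
Qed.

Theorem proposition5p2 (R : realType) (A : unitalBanachAlgType R[i]) :
  stable_rank_one (asy A) -> stable_rank_one A.
Proof.
move=> dAsy O [a Oa] oO.
have /nbhs_ballP[e /= e0 eO] : nbhs a O by exact: open_nbhs_nbhs.
have aP : (fun=> a) \in @linfty_pred R A.
  by apply/linfty_predP; exists (rnorm a).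
pose p := \pi_(asy A)%qT (Linfty aP).
have [||q [pq qU]] := dAsy (ball p e).
- by exists p; exact: ballxx.
- exact: ball_open.
have [|x xq ax] := @asy_lift_dist _ _ (Linfty aP) q (complex.Re e).
  by apply/Defs.ballE; rewrite -gt0_complexE.
have [|n xU] := @asy_unit_exists _ _ x; first by rewrite xq.
(* [ax] bounds a supremum norm, so every term of [x], in particular the invertible one, is within
   [e] of [a]. *)
exists (x n); split=> //; apply: eO; rewrite (gt0_complexE e0).
by apply/Defs.ballE/(le_lt_trans _ ax)/(linfty_rnorm_ub (Linfty aP - x) n).
Qed.
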